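(* Let $\mathfrak u\in\boldsymbol\beta\omega$ be a weak $P$-point, let $n\in\omega$, and let $\mathfrak v_0,\ldots,\mathfrak v_n\in\boldsymbol\beta\omega$ be arbitrary ultrafilters. If $\mathfrak u\le_{\mathrm C}\mathfrak v_0\otimes\ldots\otimes\mathfrak v_n$, then $\mathfrak u\le_{\mathrm{RK}}\mathfrak v_k$ for some $0\le k\le n$.
   Context: $\boldsymbol\beta\omega$ is the set of all ultrafilters over $\omega$, with $n\in\omega$ identified with the principal ultrafilter at $n$, topologized by the basic open sets $\{\mathfrak u:A\in\mathfrak u\}$, $A\subseteq\omega$. For a map $f$ of $\omega$ into a compact Hausdorff space $K$, $\widetilde f:\boldsymbol\beta\omega\to K$ is its unique continuous extension. The (Fubini) product $\mathfrak u\otimes\mathfrak v$ is the ultrafilter over $\omega\times\omega$ consisting of $S$ such that $\{x:\{y:(x,y)\in S\}\in\mathfrak v\}\in\mathfrak u$; iterated products $\mathfrak v_0\otimes\ldots\otimes\mathfrak v_n$ are defined similarly, as ultrafilters over $\omega^{n+1}$ (the product is associative up to isomorphism), and are regarded as elements of $\boldsymbol\beta\omega$ via any bijection $\omega^{n+1}\to\omega$ (the preorders below do not depend on this choice). Rudin–Keisler preorder: $\mathfrak u\le_{\mathrm{RK}}\mathfrak v$ iff there is $f:\omega\to\omega$ with $\widetilde f(\mathfrak v)=\mathfrak u$. Comfort preorder: a Tychonoff space $X$ is $\mathfrak u$-compact iff for every $f:\omega\to X$ one has $\widetilde f(\mathfrak u)\in X$, where $\widetilde f:\boldsymbol\beta\omega\to\boldsymbol\beta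 X$ and $\boldsymbol\beta X\supseteq X$ is the Čech–Stone compactification; $\mathfrak u\le_{\mathrm C}\mathfrak v$ iff every $\mathfrak v$-compact (Tychonoff) space is $\mathfrak u$-compact. An ultrafilter $\mathfrak u\in\boldsymbol\beta\omega\setminus\omega$ is a weak $P$-point iff $\mathfrak u$ does not belong to the closure of any countable set $A\subseteq\boldsymbol\beta\omega\setminus(\omega\cup\{\mathfrak u\})$. *)

(* Defs.v *)
From HB Require Import structures.
From mathcomp Require Import all_boot all_order all_algebra.
From mathcomp Require Import all_classical all_reals topology normedtype.

Set Implicit Arguments.
Unset Strict Implicit.
Unset Printing Implicit Defensive.

Import Order.TTheory GRing.Theory Num.Theory.
Import numFieldNormedType.Exports.
Local Open Scope classical_set_scope.
Local Open Scope ring_scope.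

Record ultrafilter (T : Type) := MkUltrafilter {
  ultra_sets : set_system T;
  ultra_setsP : UltraFilter ultra_sets }.

#[global] Existing Instance ultra_setsP.

Lemma ultrafilter_eq (T : Type) (u v : ultrafilter T) :
  ultra_sets u = ultra_sets v -> u = v.
Proof.
case: u v => [u uP] [v vP] /= uv; subst v.
by congr MkUltrafilter; exact: Prop_irrelevance.
Qed.

Lemma proper_dichotomy_ultra (T : Type) (F : set_system T) :
  ProperFilter F -> (forall A, F A \/ F (~` A)) -> UltraFilter F.
Proof.
move=> PF dich; split=> // G PG FG; apply/seteqP; split=> // A GA.
have [//|/FG GnA] := dich A.
by have [x []] := filter_ex (filterI GA GnA).
Qed.

HB.instance Definition _ (T : Type) := gen_eqMixin (ultrafilter T).
HB.instance Definition _ (T : Type) := gen_choiceMixin (ultrafilter T).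

Section UltrafilterTopology.
Variable T : Type.

Definition ultra_base (A : set T) : set (ultrafilter T) :=
  [set u | ultra_sets u A].

Lemma ultra_base_cover : \bigcup_(A in [set: set T]) ultra_base A = setT.
Proof. by apply/seteqP; split=> // u _; exists setT => //; exact: filterT. Qed.

Lemma ultra_base_join (A B : set T) (u : ultrafilter T) :
  [set: set T] A -> [set: set T] B -> ultra_base A u -> ultra_base B u ->
  exists C, [/\ [set: set T] C, ultra_base C u
               & ultra_base C `<=` ultra_base A `&` ultra_base B].
Proof.
move=> _ _ uA uB; exists (A `&` B); split=> //; first exact: filterI.
by move=> v vAB; split; apply: filterS vAB => x [].
Qed.

HB.instance Definition _ := isBaseTopological.Build (ultrafilter T)
  ultra_base_cover ultra_base_join.

Lemma nbhs_ultraE (u : ultrafilter T) (V : set (ultrafilter T)) :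
  nbhs u V <-> exists2 A, ultra_sets u A & ultra_base A `<=` V.
Proof.
rewrite nbhsE; split=> [[_ [[D _ <-] [A DA uA]] DV]|[A uA AV]].
  by exists A => // v vA; apply: DV; exists A.
exists (ultra_base A) => //; split=> //.
by exists [set A] => //; rewrite bigcup_set1.
Qed.

End UltrafilterTopology.

Notation beta_omega := (ultrafilter nat).

Definition principal (T : Type) (x : T) : ultrafilter T :=
  MkUltrafilter (principal_filter_ultra x).

Lemma ultra_map_subproof (T U : Type) (f : T -> U) (u : ultrafilter T) :
  UltraFilter [set A : set U | ultra_sets u (f @^-1` A)].
Proof.
apply: (proper_dichotomy_ultra (fmap_proper_filter f _)) => A.
exact: (in_ultra_setVsetC (f @^-1` A) (ultra_setsP u)).
Qed.

Definition ultra_map (T U : Type) (f : T -> U) (u : ultrafilter T) :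
  ultrafilter U := MkUltrafilter (ultra_map_subproof f u).

(* The default value is irrelevant when K is compact Hausdorff: then the set
   below is a singleton, by beta_ext_continuous, beta_ext_principal and
   beta_ext_unique. *)
Definition beta_ext (K : topologicalType) (f : nat -> K) : beta_omega -> K :=
  xget (fun=> f 0%N)
    [set g | continuous g /\ forall n, g (principal n) = f n].

Section BetaExt.
Variable K : topologicalType.
Hypotheses (Kcompact : compact [set: K]) (Khausdorff : hausdorff_space K).

Lemma beta_ext_exists (f : nat -> K) :
  exists g : beta_omega -> K,
    continuous g /\ forall n, g (principal n) = f n.
Proof.
have lim_ex (u : beta_omega) : exists p : K, ultra_sets (ultra_map f u) --> p.
  have := Kcompact; rewrite compact_ultra => /(_ (ultra_sets (ultra_map f u))).
  by case=> [|p [_ fp]]; [exact: filterT | exists p].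
pose g u := projT1 (cid (lim_ex u)).
have gP u : ultra_sets (ultra_map f u) --> g u by exact: projT2 (cid (lim_ex u)).
exists g; split=> [u V /= gV|n].
  have [W gW WV] := compact_regular Khausdorff Kcompact filterT gV.
  apply/nbhs_ultraE; exists (f @^-1` W); first exact: gP gW.
  move=> v /= vW; apply: WV => B gB.
  have [m [Wm Bm]] := @filter_ex _ (ultra_sets v) _ _ (filterI vW (gP v _ gB)).
  by exists (f m).
apply: Khausdorff => A B gA fB; exists (f n); split; last exact: nbhs_singleton.
by have := gP (principal n) _ gA; rewrite /= /principal_filter; apply.
Qed.

Lemma beta_ext_continuous (f : nat -> K) : continuous (beta_ext f).
Proof. by have /(xgetPex (fun=> f 0%N)) [] := beta_ext_exists f. Qed.

Lemma beta_ext_principal (f : nat -> K) n : beta_ext f (principal n) = f n.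
Proof. by have /(xgetPex (fun=> f 0%N)) [_] := beta_ext_exists f; apply. Qed.

Lemma beta_ext_unique (f : nat -> K) (g : beta_omega -> K) :
  continuous g -> (forall n, g (principal n) = f n) -> g = beta_ext f.
Proof.
move=> cg gf; apply/funext => u; apply: Khausdorff => A B.
move=> /cg /nbhs_ultraE [C uC CA].
move=> /(@beta_ext_continuous f) /nbhs_ultraE [D uD DB].
have [n [Cn Dn]] := @filter_ex _ (ultra_sets u) _ _ (filterI uC uD).
exists (f n); split; first by rewrite -gf; apply: CA; exact/principal_filterP.
by rewrite -(beta_ext_principal f); apply: DB; exact/principal_filterP.
Qed.

End BetaExt.

Lemma beta_omega_hausdorff : hausdorff_space beta_omega.
Proof.
move=> u v uv; apply: ultrafilter_eq; apply: (@max_filter _ _ (ultra_setsP v)) => A vA.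
have [//|unA] := in_ultra_setVsetC A (ultra_setsP u).
have [||w [wnA wA]] := uv (ultra_base (~` A)) (ultra_base A).
- by apply/nbhs_ultraE; exists (~` A).
- by apply/nbhs_ultraE; exists A.
- by have [x []] := @filter_ex _ (ultra_sets w) _ _ (filterI wnA wA).
Qed.

Lemma beta_omega_compact : compact [set: beta_omega].
Proof.
rewrite compact_ultra => F FU _.
have dich (A : set nat) : F (ultra_base A) \/ F (ultra_base (~` A)).
  have [|FnA] := in_ultra_setVsetC (ultra_base A) FU; first by left.
  right; apply: filterS FnA => w nwA.
  by have [//|] := in_ultra_setVsetC A (ultra_setsP w).
have PF : ProperFilter [set A | F (ultra_base A)].
  split; first by move=> /(@filter_ex _ F) [w]; exact: filter_not_empty.
  split=> [|A B FA FB|A B AB FA].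
  - by apply: (@filterS _ F _ _ _ _ filterT) => w _; exact: filterT.
  - by apply: (@filterS2 _ F _ _ _ _ _ FA FB) => w; exact: filterI.
  - by apply: (@filterS _ F _ _ _ _ FA) => w; exact: filterS.
exists (MkUltrafilter (proper_dichotomy_ultra PF dich)); split=> // V.
by move=> /nbhs_ultraE [A FA AV]; exact: (@filterS _ F _ _ _ AV FA).
Qed.

Definition rk_le (u v : beta_omega) : Prop :=
  exists f : nat -> nat, beta_ext (fun n => principal (f n)) v = u.

Lemma fubini_subproof (S T : Type) (u : ultrafilter S) (v : ultrafilter T) :
  UltraFilter [set A : set (S * T) |
    ultra_sets u [set x | ultra_sets v [set y | A (x, y)]]].
Proof.
apply: proper_dichotomy_ultra => [|A]; last first.
  have [?|uA] :=
    in_ultra_setVsetC [set x | ultra_sets v [set y | A (x, y)]] (ultra_setsP u).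
    by left.
  right; apply: (@filterS _ (ultra_sets u) _ _ _ _ uA) => x nvA /=.
  by have [//|] := in_ultra_setVsetC [set y | A (x, y)] (ultra_setsP v).
split.
  by move=> /(@filter_ex _ (ultra_sets u)) [x]; exact: filter_not_empty.
split=> [|A B uA uB|A B AB uA].
- apply: (@filterS _ (ultra_sets u) _ _ _ _ filterT) => x _.
  exact: (@filterT _ (ultra_sets v)).
- apply: (@filterS2 _ (ultra_sets u) _ _ _ _ _ uA uB) => x.
  exact: (@filterI _ (ultra_sets v)).
- apply: (@filterS _ (ultra_sets u) _ _ _ _ uA) => x.
  by apply: (@filterS _ (ultra_sets v)) => y; exact: AB.
Qed.

Definition fubini (S T : Type) (u : ultrafilter S) (v : ultrafilter T) :
  ultrafilter (S * T) := MkUltrafilter (fubini_subproof u v).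

(* omega_pow n is omega^(n+1), as right-nested pairs *)
Fixpoint omega_pow (n : nat) : Type :=
  if n is m.+1 then (nat * omega_pow m)%type else nat.

Lemma omega_pow_bij (n : nat) : exists e : omega_pow n -> nat, bijective e.
Proof.
have /card_set_bijP [c] := card_nat2; rewrite setTT_bijective => -[d cd dc].
elim: n => [|n [e [e' ee' e'e]]]; first by exists id; exists id.
exists (fun p => c (p.1, e p.2)); exists (fun k => ((d k).1, e' (d k).2)).
  by move=> [x y] /=; rewrite cd /= ee'.
by move=> k /=; rewrite e'e -surjective_pairing dc.
Qed.

Fixpoint fubini_iter (n : nat) :
    ('I_n.+1 -> beta_omega) -> ultrafilter (omega_pow n) :=
  match n with
  | 0 => fun v => v ord0
  | m.+1 => fun v => fubini (v ord0) (fubini_iter (fun i => v (lift ord0 i)))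
  end.

Definition weak_P_point (u : beta_omega) : Prop :=
  ~ range (@principal nat) u /\
  forall A : set beta_omega, countable A ->
    A `<=` ~` (range (@principal nat) `|` [set u]) -> ~ closure A u.

(* completely_regular_space is phrased with uniform separators; by
   uniform_separatorP these are separating maps into [0, 1] *)
Definition tychonoff_space (X : topologicalType) : Prop :=
  hausdorff_space X /\ completely_regular_space X.

(* Closure of the image of X under evaluation in the cube [0, 1]^C(X, [0, 1]).
   When X is Tychonoff, cs_embed is a dense embedding into a compact Hausdorff
   space to which [0, 1]-valued continuous maps extend. *)
Section CechStone.
Variables (R : realType) (X : topologicalType).

Definition unit_fun : Type :=
  {f : X -> R | continuous f /\ forall x, 0 <= f x <= 1}.

Definition cs_eval (x : X) : {ptws unit_fun -> R} := fun f => sval f x.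

Definition cech_stone : Type := set_type (closure (range cs_eval)).

HB.instance Definition _ := Topological.on cech_stone.

Lemma cs_embed_subproof (x : X) : cs_eval x \in closure (range cs_eval).
Proof. by apply/mem_set/subset_closure; exists x. Qed.

Definition cs_embed (x : X) : cech_stone := 
  exist (fun y => y \in closure (range cs_eval)) _ (cs_embed_subproof x).

Definition cs_coord (f : unit_fun) (p : cech_stone) : R := set_val p f.

Lemma cs_coord_continuous (f : unit_fun) : continuous (cs_coord f).
Proof.
move=> p; apply: (@continuous_comp _ {ptws unit_fun -> R} _
  (set_val : cech_stone -> _) (fun g => g f)).
  exact: initial_continuous.
exact: (@proj_continuous {classic unit_fun} (fun=> R)).
Qed.

Lemma cech_stone_hausdorff : hausdorff_space cech_stone.
Proof.
move=> p q pq; apply: val_inj; apply/funext => f.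
apply: (@norm_hausdorff R R) => A B.
move=> /(@cs_coord_continuous f p) pA /(@cs_coord_continuous f q) qB.
by have [r [Ar Br]] := pq _ _ pA qB; exists (cs_coord f r).
Qed.

Lemma cech_stone_compact : compact [set: cech_stone].
Proof.
have cpt : compact (closure (range cs_eval)).
  apply: (@subclosed_compact _ _
    [set g : {ptws unit_fun -> R} | forall f, `[0, 1]%classic (g f)]).
  - exact: closed_closure.
  - apply: (@tychonoff {classic unit_fun} (fun=> R) (fun=> `[0, 1]%classic)).
    by move=> _; exact: segment_compact.
  - move=> g gcl f; have cl01 : closed (`[0, 1]%classic : set R).
      exact: interval_closed.
    apply: cl01 => B /(@proj_continuous {classic unit_fun} (fun=> R) f) /gcl.
    case=> [_ [[x _ <-] Bx]]; exists (sval f x); split=> //=.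
    by rewrite in_itv /=; exact: (svalP f).2.
move=> F PF _.
have [|p [Ap clp]] := cpt (fmap set_val F) _.
  by apply: (@filterS _ F _ _ _ _ filterT) => q _; exact: set_valP.
exists (exist _ p (mem_set Ap)); split=> // B V FB [_ [[W oW <-] Wp WV]].
have [|_ [[q Bq <-] Wq]] := clp (set_val @` B) W _ (open_nbhs_nbhs (conj oW Wp)).
  by apply: (@filterS _ F _ _ _ _ FB) => q Bq; exists q.
by exists q; split=> //; exact: WV.
Qed.

Lemma cs_embed_dense : dense (range cs_embed).
Proof.
move=> O [p Op] [W oW WO]; rewrite -WO in Op *.
have [_ [[x _ <-] Wx]] := set_valP p W (open_nbhs_nbhs (conj oW Op)).
by exists (cs_embed x); split=> //; exists x.
Qed.

Lemma cs_embed_continuous : continuous cs_embed.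
Proof.
move=> x V [_ [[W oW <-] Wx WV]].
have cx : {for x, continuous cs_eval}.
  apply/cvg_sup => f U [_ [[A oA <-] Ax AU]].
  have fA := (svalP f).1 x A (open_nbhs_nbhs (conj oA Ax)).
  by apply: (@filterS _ (nbhs x) _ _ _ _ fA) => y Ay; exact: AU.
have nW := cx W (open_nbhs_nbhs (conj oW Wx)).
by apply: (@filterS _ (nbhs x) _ _ _ _ nW) => y Wy; exact: WV.
Qed.

Lemma cs_embed_nbhs (x : X) (V : set X) : tychonoff_space X -> nbhs x V ->
  exists2 W, nbhs (cs_embed x) W & cs_embed @^-1` W `<=` V.
Proof.
move=> [_ crX]; rewrite nbhsE => -[U [oU Ux] UV].
have /(@uniform_separatorP _ R) [f [cf f01 fx fU]] :=
  crX x (~` U) (open_closedC oU) (fun nUx => nUx Ux).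
have fP y : 0 <= f y <= 1.
  by have := f01 (f y); rewrite /= in_itv; apply; exists y.
pose F : unit_fun := exist _ f (conj cf fP).
have Fx : cs_coord F (cs_embed x) = 0 by apply: fx; exists x.
exists (cs_coord F @^-1` [set r | r < 1]).
  apply: cs_coord_continuous; rewrite Fx.
  by apply: open_nbhs_nbhs; split; [exact: open_lt | exact: ltr01].
move=> y /= Fy; apply: UV; apply: contrapT => nUy.
have fy : f y = 1 by apply: fU; exists y.
by move: Fy; rewrite [cs_coord _ _]fy ltxx.
Qed.

Lemma cs_embed_inj : tychonoff_space X -> injective cs_embed.
Proof.
move=> tX x y xy; apply: tX.1 => A B xA yB.
have [W yW WB] := cs_embed_nbhs tX yB; exists x; split.
  exact: nbhs_singleton.
by apply: WB; rewrite /= xy; exact: nbhs_singleton.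
Qed.

Lemma cs_extend (f : X -> R) : continuous f -> (forall x, 0 <= f x <= 1) ->
  exists2 g : cech_stone -> R, continuous g & forall x, g (cs_embed x) = f x.
Proof.
move=> cf f01; pose F : unit_fun := exist _ f (conj cf f01).
by exists (cs_coord F) => //; exact: cs_coord_continuous.
Qed.

End CechStone.

(* R only serves as a model of the real line in the construction of the
   Cech-Stone compactification *)
Definition ultra_compact (R : realType) (u : beta_omega)
    (X : topologicalType) : Prop :=
  forall f : nat -> X,
    range (@cs_embed R X) (beta_ext (fun n => @cs_embed R X (f n)) u).

Definition comfort_le (R : realType) (u v : beta_omega) : Prop :=
  forall X : topologicalType, tychonoff_space X ->
    ultra_compact R v X -> ultra_compact R u X.

(* Main.v *)
Require Import Defs.
From mathcomp Require Import all_boot all_order all_algebra.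
From mathcomp Require Import all_classical all_reals topology normedtype.

(** The subspace X of beta omega obtained by removing u is not u-compact, since
    the inclusion of omega has u-limit u.  If u is a weak P-point and X is not
    v-compact, then u is a v-limit of a sequence in X; v-almost all terms of
    that sequence are principal, as u is not in the closure of countably many
    other free ultrafilters, whence u <=_RK v.  So if u is RK-below no v_k, then
    X is v_k-compact for every k, and iterating limits makes X compact for the
    Fubini product, against the Comfort inequality. *)

Set Implicit Arguments.
Unset Strict Implicit.
Unset Printing Implicit Defensive.

Local Open Scope classical_set_scope.

(** Compactness along [v] stated by limits inside [X], without the compactification; the index type
    is arbitrary so that it applies directly to ultrafilters over products. *)
Definition ultra_lim_complete (T : Type) (v : ultrafilter T)
    (X : topologicalType) : Prop :=
  forall f : T -> X, exists y : X, f @ ultra_sets v --> y.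

Lemma beta_extP (K : topologicalType) (f : nat -> K) (v : beta_omega) (p : K) :
  compact [set: K] -> hausdorff_space K ->
  beta_ext f v = p <-> f @ ultra_sets v --> p.
Proof.
move=> cK hK; have lim_v : f @ ultra_sets v --> beta_ext f v.
  move=> V /(@beta_ext_continuous _ cK hK f v) /nbhs_ultraE [A vA AV].
  apply: (@filterS _ (ultra_sets v) _ _ _ _ vA) => n An.
  rewrite /= -(beta_ext_principal cK hK f n); apply: AV.
  exact/principal_filterP.
split=> [<- //|]; exact: (cvg_unique hK lim_v).
Qed.

(** The value of the extension at [v] is the [v]-limit in the compactification, and [cs_embed] is a
    topological embedding, so this limit lies in the image of [X] exactly when the sequence
    converges in [X]. *)
Lemma ultra_compactP (R : realType) (v : beta_omega) (X : topologicalType) :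
  tychonoff_space X -> ultra_compact R v X <-> ultra_lim_complete v X.
Proof.
move=> tX; have cK := @cech_stone_compact R X; have hK := @cech_stone_hausdorff R X.
split=> vX f; have [y] := vX f; last first.
  move=> fy; exists y => //; apply/esym/(beta_extP _ _ _ cK hK).
  exact: (cvg_comp _ _ fy (@cs_embed_continuous R X y)).
move=> _ /esym /(beta_extP _ _ _ cK hK) fy; exists y => V yV.
have [W yW WV] := cs_embed_nbhs R tX yV.
apply: (@filterS _ (ultra_sets v) _ _ _ _ (fy _ yW)) => n; exact: WV.
Qed.

Lemma ultra_lim_complete_map (S T : Type) (e : S -> T) (v : ultrafilter S)
    (X : topologicalType) :
  ultra_lim_complete v X -> ultra_lim_complete (ultra_map e v) X.
Proof. by move=> vX f; have [y] := vX (f \o e); exists y. Qed.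

(** A limit along the product is an iterated limit: [h s] is the [w]-limit of the row at [s], and
    [y] is the [v]-limit of [h]. *)
Lemma ultra_lim_complete_fubini (S T : Type) (v : ultrafilter S)
    (w : ultrafilter T) (X : topologicalType) :
  ultra_lim_complete v X -> ultra_lim_complete w X ->
  ultra_lim_complete (fubini v w) X.
Proof.
move=> vX wX f.
have [h hP] := boolp.choice (fun s : S => wX (fun t => f (s, t))).
(* Being open, [O] is a neighbourhood of [h s] as well, for [v]-almost all [s]. *)
have [y hy] := vX h; exists y => V; rewrite nbhsE => -[O [oO Oy] OV].
apply: (@filterS _ (ultra_sets v) _ _ _ _ (hy _ (open_nbhs_nbhs (conj oO Oy)))).
move=> s /= Os.
apply: (@filterS _ (ultra_sets w) _ _ _ _ (hP s _ (open_nbhs_nbhs (conj oO Os)))).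
move=> t; exact: OV.
Qed.

Lemma ultra_lim_complete_fubini_iter (n : nat) (v : 'I_n.+1 -> beta_omega)
    (X : topologicalType) :
  (forall k, ultra_lim_complete (v k) X) ->
  ultra_lim_complete (fubini_iter v) X.
Proof.
elim: n v => [|n IHn] v vX; first exact: vX.
by apply: ultra_lim_complete_fubini => //; exact: IHn.
Qed.

Lemma nbhs_set_typeE (T : topologicalType) (A : set T) (x : set_type A)
    (V : set (set_type A)) :
  nbhs x V <-> exists2 W, nbhs (set_val x) W & set_val @^-1` W `<=` V.
Proof.
split=> [[_ [[W oW <-] Wx WV]]|[W]].
  by exists W => //; exact: open_nbhs_nbhs.
rewrite nbhsE => -[O [oO Ox] OW] WV; exists (set_val @^-1` O); split=> //.
  by exists O.
by move=> y Oy; apply: WV; exact: OW.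
Qed.

Lemma cvg_set_val (T : topologicalType) (A : set T) (S : Type)
    (v : ultrafilter S) (f : S -> set_type A) (x : set_type A) :
  f @ ultra_sets v --> x <->
  (fun s => set_val (f s)) @ ultra_sets v --> set_val x.
Proof.
split=> fx V.
  by move=> xV; apply: (fx (set_val @^-1` V)); apply/nbhs_set_typeE; exists V.
move=> /nbhs_set_typeE [W xW WV].
by apply: (@filterS _ (ultra_sets v) _ _ _ _ (fx _ xW)) => s; exact: WV.
Qed.

(** Separators restrict: some open [W] around [x] has its trace outside [B], and a function on [T]
    separating [x] from the complement of [W] separates [x] from [B]. *)
Lemma tychonoff_set_type (R : realType) (T : topologicalType) (A : set T) :
  tychonoff_space T -> tychonoff_space (set_type A).
Proof.
move=> [hT crT]; split=> [x y xy|x B cB nBx].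
  apply: val_inj; apply: hT => U V xU yV.
  have [||z [Uz Vz]] := xy (set_val @^-1` U) (set_val @^-1` V).
  - by apply/nbhs_set_typeE; exists U.
  - by apply/nbhs_set_typeE; exists V.
  by exists (set_val z).
have [_ [[W oW <-] Wx WB]] := open_nbhs_nbhs (conj (closed_openC cB) nBx).
have /(@uniform_separatorP _ R) [f [cf f01 fx fW]] :=
  crT (set_val x) (~` W) (open_closedC oW) (fun nWx => nWx Wx).
apply/(@uniform_separatorP _ R); exists (f \o set_val); split.
- move=> z V /cf fV; apply/nbhs_set_typeE.
  by exists (f @^-1` V).
- by move=> _ [z _ <-]; apply: f01; exists (set_val z).
- by move=> _ [_ -> <-]; apply: fx; exists (set_val x).
- move=> _ [z Bz <-]; apply: fW; exists (set_val z) => // Wz.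
  exact: WB Wz Bz.
Qed.

Lemma tychonoff_beta_omega (R : realType) : tychonoff_space beta_omega.
Proof.
split; first exact: beta_omega_hausdorff.
have hK := beta_omega_hausdorff.
have nK := compact_normal hK beta_omega_compact.
exact: (@normal_completely_regular R _ nK (hausdorff_accessible hK)).
Qed.

Lemma weak_P_point_rk_le (u v : beta_omega) (f : nat -> beta_omega) :
  weak_P_point u -> (forall n, f n <> u) -> f @ ultra_sets v --> u ->
  rk_le u v.
Proof.
move=> [_ wPu] fu fvu; pose P := f @^-1` range (@principal nat).
have [vP|vnP] := in_ultra_setVsetC P (ultra_setsP v).
  have Pm n : exists m, P n -> principal m = f n.
    have [[m _ <-]|nPn] := pselect (P n); first by exists m.
    (* A default outside [P], harmless for the limit because [P] belongs to [v]. *)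
    by exists 0.
  have [g gP] := boolp.choice Pm.
  exists g; apply/(beta_extP _ _ _ beta_omega_compact beta_omega_hausdorff) => V.
  move=> /fvu vV.
  apply: (@filterS2 _ (ultra_sets v) _ _ _ _ _ vP vV) => n Pn.
  by rewrite /= gP.
(* If [f] is free [v]-almost everywhere, its free values form a countable set of ultrafilters other
   than [u] that accumulates at [u]. *)
exfalso; apply: (wPu (f @` ~` P)).
- exact: sub_countable (card_image_le f _) (countableP _).
- by move=> _ [n nPn <-] [|/fu].
- move=> V /fvu vV.
  have [n [nPn Vn]] := @filter_ex _ (ultra_sets v) _ _ (filterI vnP vV).
  by exists (f n); split=> //; exists n.
Qed.

Theorem theorem2 (R : realType) (u : beta_omega) (n : nat)
    (v : 'I_n.+1 -> beta_omega) (e : omega_pow n -> nat) :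
  weak_P_point u -> bijective e ->
  comfort_le R u (ultra_map e (fubini_iter v)) ->
  exists k : 'I_n.+1, rk_le u (v k).
Proof.
move=> wPu _ uv; apply: contrapT => /forallNP nrk.
have tX := @tychonoff_set_type R _ (~` [set u]) (tychonoff_beta_omega R).
have cptK := beta_omega_compact; have hausK := beta_omega_hausdorff.
have /(ultra_compactP R u tX) uX : ultra_compact R u (set_type (~` [set u])).
  apply: uv => //; apply/(ultra_compactP R _ tX)/ultra_lim_complete_map.
  apply: ultra_lim_complete_fubini_iter => k f.
  pose g n := set_val (f n).
  pose p := beta_ext g (v k).
  have gp := (beta_extP g (v k) p cptK hausK).1 erefl.
  (* The limit taken in [beta_omega] stays in the subspace: were it [u], then [u] would be RK-below
     [v k]. *)
  have pu : (~` [set u]) p.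
    move=> /= pu; rewrite pu in gp.
    by apply/(nrk k)/(weak_P_point_rk_le wPu _ gp) => m; exact: set_valP (f m).
  exists (exist _ p (mem_set pu)).
  exact: (cvg_set_val (v k) f (exist _ p (mem_set pu))).2 gp.
(* As [u] is free, all of omega lies in the subspace; the inclusion then has [u]-limit both [y]
   there and [u] in [beta_omega]. *)
have u_free m : (~` [set u]) (principal m).
  by move=> mu; apply: wPu.1; exists m.
pose inc m : set_type (~` [set u]) := exist _ (principal m) (mem_set (u_free m)).
have [y uy] := uX inc.
have {}uy : (@principal nat) @ ultra_sets u --> set_val y :=
  (cvg_set_val u inc y).1 uy.
have incu : (@principal nat) @ ultra_sets u --> u.
  move=> V /nbhs_ultraE [A uA AV].
  apply: (@filterS _ (ultra_sets u) _ _ _ _ uA) => m Am.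
  exact/AV/principal_filterP.
have yu : set_val y = u by exact: (cvg_unique hausK uy incu).
exact: (set_valP y) yu.
Qed.
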